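(* Let $E,A\in\mathbb{R}^{n\times n}$ and $C\in\mathbb{R}^{m\times n}$, with $E$ singular and the pencil $sE-A$ regular, and let $T,S,A_1,N,C_1,C_2$ be a Weierstrass canonical decomposition of $(E,A,C)$. For $r\in\{0,1,\ldots,n-1\}$ consider the condition $$(\ast_r)\qquad \operatorname{rank}\begin{bmatrix}N^{r+2}\\ C_2N\\ C_2N^2\\ \vdots\\ C_2N^{r+1}\end{bmatrix}=\operatorname{rank}(N).$$ Then the following statements are equivalent: 1) the system $E\dot x(t)=Ax(t),\ y(t)=Cx(t)$ is impulse observable; 2) $(\ast_r)$ holds for some $r\in\{0,1,\ldots,n-1\}$; 3) $(\ast_r)$ holds for every $r\in\{0,1,\ldots,n-1\}$.
   Context: The pencil $sE-A$ is regular if $\det(sE-A)$ is not the zero polynomial in $s$. $\mathbb{R}^n(s)$ denotes the set of $n$-dimensional vectors of rational functions in $s$ (with real coefficients). Every $F(s)\in\mathbb{R}^n(s)$ is uniquely a sum $F=F_{\mathrm A}+F_{\mathrm P}$ of a vector $F_{\mathrm A}$ of strictly proper rational functions and a polynomial vector $F_{\mathrm P}$ (the polynomial part). Definition (impulse observability): the system $E\dot x=Ax,\ y=Cx$ is impulse observable if the equation $$\begin{bmatrix} sE-A\\ C\end{bmatrix}X(s)=\begin{bmatrix}Ew\\0\end{bmatrix}$$ in the unknowns $(w,X(s))\in\mathbb{R}^n\times\mathbb{R}^n(s)$ has no solution with $X_{\mathrm P}(s)$ nonzero. Weierstrass canonical decomposition of $(E,A,C)$: invertible matrices $T,S\in\mathbb{R}^{n\times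 n}$, integers $n_1+n_2=n$, and real matrices $A_1$ ($n_1\times n_1$), $N$ ($n_2\times n_2$, nilpotent), $C_1$ ($m\times n_1$), $C_2$ ($m\times n_2$) such that $$\begin{bmatrix}T&0\\0&I\end{bmatrix}\begin{bmatrix}sE-A\\C\end{bmatrix}S=\begin{bmatrix}sI_{n_1}-A_1&0\\0&sN-I_{n_2}\\C_1&C_2\end{bmatrix}.$$ *)

(* Defs.v *)
From mathcomp Require Import all_boot all_order all_algebra.
From mathcomp Require Import reals.

Set Implicit Arguments.
Unset Strict Implicit.
Unset Printing Implicit Defensive.

Import Order.TTheory GRing.Theory Num.Theory.
Local Open Scope ring_scope.

Notation ratfun R := {fraction {poly R}}.
Notation polymx := (map_mx polyC).
Notation ratmx := (map_mx (@tofrac _)).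

Lemma frac_subE (K : fieldType) (a b c d p q : K) :
  b != 0 -> d != 0 -> a / b + p = c / d + q ->
  (p - q) * (b * d) = c * b - a * d.
Proof.
move=> b0 d0 e; have -> : p - q = c / d - a / b.
  by apply/eqP; rewrite subr_eq addrAC eq_sym subr_eq -e addrC.
rewrite mulrBl [b * d]mulrC mulrA divfK //.
by rewrite [d * b]mulrC mulrA divfK.
Qed.

Section RationalVectors.
Variable R : realType.

Definition strictly_proper (f : ratfun R) : Prop :=
  exists p q : {poly R},
    [/\ q != 0, (size p < size q)%N & f = tofrac p / tofrac q].

(* P is the polynomial part F_P; it exists and is unique, see poly_partP. *)
Definition poly_part n (F : 'cV[ratfun R]_n) (P : 'cV[{poly R}]_n) : Prop :=
  exists2 FA : 'cV[ratfun R]_n,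
    forall i, strictly_proper (FA i 0) & F = FA + ratmx P.

Lemma fracE (f : ratfun R) :
  exists p q : {poly R}, q != 0 /\ f = tofrac p / tofrac q.
Proof.
elim/quotW: f => -[[p q] /= q0].
exists p, q; split=> //.
have qF0 : tofrac q != 0 by rewrite tofrac_eq0.
apply: (mulIf qF0); rewrite divfK // !piE.
apply/eqP; rewrite /GRing.mul /= !piE /= FracField.equivfE /=.
by rewrite /FracField.mulf !numer_Ratio ?denom_Ratio ?mulr1 ?oner_neq0 // mulrC.
Qed.

Lemma strictly_proper_polyB (f g : ratfun R) (p q : {poly R}) :
  strictly_proper f -> strictly_proper g ->
  f + tofrac p = g + tofrac q -> p = q.
Proof.
move=> [a [b [b0 ab ->]]] [c [d [d0 cd ->]]] e.
have bF : tofrac b != 0 by rewrite tofrac_eq0.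
have dF : tofrac d != 0 by rewrite tofrac_eq0.
apply/eqP; rewrite -subr_eq0; apply/negPn/negP => h0.
have e1 : (p - q) * (b * d) = c * b - a * d.
  apply/eqP; rewrite -tofrac_eq; apply/eqP.
  by have H := frac_subE bF dF e; rewrite tofracM !tofracB !tofracM H.
have sbd : (size (c * b - a * d)%R < size (b * d)%R)%N.
  rewrite size_mul // (leq_ltn_trans (size_polyD _ _)) // size_polyN gtn_max.
  have sb : (0 < size b)%N by rewrite size_poly_gt0.
  have sd : (0 < size d)%N by rewrite size_poly_gt0.
  have H u v k : (size u < size v)%N -> (0 < k)%N ->
    ((size u + k).-1 < (size v + k).-1)%N.
    by case: k => // k uv _; rewrite !addnS /= ltn_add2r.
  apply/andP; split.
    apply: leq_ltn_trans (size_polyMleq _ _) _.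
    by rewrite [(size b + _)%N]addnC; apply: H.
  by apply: leq_ltn_trans (size_polyMleq _ _) _; apply: H.
move: sbd; rewrite -e1 ltnNge => /negP; apply.
by rewrite [leqRHS]size_mul ?mulf_neq0 // -subn1 -addnBAC ?size_poly_gt0 // leq_addl.
Qed.

Lemma poly_partP n (F : 'cV[ratfun R]_n) : exists! P, poly_part F P.
Proof.
have [g Pg] : exists g : 'I_n -> {poly R},
    forall i, exists2 fa, strictly_proper fa & F i 0 = fa + tofrac (g i).
  apply: (@fin_all_exists 'I_n (fun=> {poly R}) (fun i p =>
    exists2 fa, strictly_proper fa & F i 0 = fa + tofrac p)) => i.
  have [p [q [q0 ->]]] := fracE (F i 0).
  have qF : tofrac q != 0 by rewrite tofrac_eq0.
  exists (p %/ q); exists (tofrac (p %% q) / tofrac q).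
    by exists (p %% q), q; split=> //; rewrite ltn_modp.
  rewrite {1}(divp_eq p q) tofracD tofracM mulrDl mulfK //.
  exact: addrC.
exists (\col_i g i); split.
  exists (F - ratmx (\col_i g i)); last by rewrite subrK.
  move=> i; have [fa sfa e] := Pg i.
  by rewrite !mxE e addrK.
move=> P [FA sFA e]; apply/colP => i; rewrite mxE.
have [fa sfa ei] := Pg i.
apply: (strictly_proper_polyB sfa (sFA i)).
by rewrite -ei e !mxE.
Qed.

End RationalVectors.

Section Systems.
Variable R : realType.

Definition pencil n (E A : 'M[R]_n) : 'M[{poly R}]_n :=
  'X *: polymx E - polymx A.

Definition regular_pencil n (E A : 'M[R]_n) : Prop := \det (pencil E A) != 0.

Definition impulse_observable n m (E A : 'M[R]_n) (C : 'M[R]_(m, n)) : Prop :=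
  ~ exists (w : 'cV[R]_n) (X : 'cV[ratfun R]_n) (XP : 'cV[{poly R}]_n),
      [/\ ratmx (col_mx (pencil E A) (polymx C)) *m X
            = ratmx (polymx (col_mx (E *m w) 0)),
          poly_part X XP
        & XP != 0].

Definition nilpotent_mx n (N : 'M[R]_n) : Prop := exists k, N ^+ k = 0.

Definition weierstrass_decomposition n m n1 n2 (hn : (n1 + n2)%N = n)
    (E A : 'M[R]_n) (C : 'M[R]_(m, n)) (T S : 'M[R]_n)
    (A1 : 'M[R]_n1) (N : 'M[R]_n2) (C1 : 'M[R]_(m, n1)) (C2 : 'M[R]_(m, n2))
    : Prop :=
  [/\ T \in unitmx, S \in unitmx, nilpotent_mx N
    & block_mx (polymx T) 0 0 1%:M *m col_mx (pencil E A) (polymx C)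
        *m polymx S
      = col_mx
          (castmx (hn, hn)
            (block_mx ('X *: 1%:M - polymx A1) 0
                      0 ('X *: polymx N - 1%:M)))
          (castmx (erefl m, hn) (row_mx (polymx C1) (polymx C2)))].

Definition rank_condition n2 m (N : 'M[R]_n2) (C2 : 'M[R]_(m, n2)) (r : nat)
    : Prop :=
  \rank (col_mx (N ^+ r.+2) (\mxcol_(i < r.+1) (C2 *m N ^+ i.+1))) = \rank N.

End Systems.

(* Main.v *)
Require Import Defs.
From mathcomp Require Import all_boot all_order all_algebra.
From mathcomp Require Import reals.

(** Changing coordinates by [T] and [S] reduces impulse observability to the
    Weierstrass form.  There, [(sI - A1) X1 = w1] forces [X1] to be strictly
    proper, while [(sN - I) X2 = N v] forces
    [X2 = - \sum_i s^i N^(i+1) v], a polynomial.  The output equation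
    [C1 X1 + C2 X2 = 0] splits along these two parts, so the system is impulse
    observable iff [N v = 0] whenever [C2 N^(i+1) v = 0] for all [i].  The rank
    condition says the same with finitely many [i] and [N^(r+2) v = 0]; it
    implies the former by applying it to the last [N^k v] with
    [N^(k+1) v != 0], which is killed by [N^2]. *)

Set Implicit Arguments.
Unset Strict Implicit.
Unset Printing Implicit Defensive.

Import Order.TTheory GRing.Theory Num.Theory.
Local Open Scope ring_scope.

(** * Degree bounds for determinants and adjugates of linear pencils *)

Lemma size_det_affine (R : idomainType) n (M : 'M[{poly R}]_n) :
  (forall i j, (size (M i j) <= 2)%N) -> (size (\det M) <= n.+1)%N.
Proof.
move=> sM; apply: leq_trans (size_sum _ _ _) _; apply/bigmax_leqP => s _.
rewrite size_Msign; apply: leq_trans (size_poly_prod_leq _ _) _.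
have -> : #|[pred i : 'I_n | xpredT i]| = n.
  by rewrite -[RHS]card_ord; apply: eq_card.
rewrite leq_subLR.
(* A product of [n] entries has size at most one plus the sum of their sizes minus [n], here
   [2n + 1 - n]. *)
apply: (@leq_trans (\sum_(i < n) 2).+1); first by rewrite ltnS; apply: leq_sum.
by rewrite sum_nat_const card_ord muln2 -addnn addnS.
Qed.

Lemma size_char_poly_mx_entry (R : nzRingType) n (A : 'M[R]_n) i j :
  (size (char_poly_mx A i j) <= 2)%N.
Proof.
rewrite !mxE; apply: leq_trans (size_polyD _ _) _.
rewrite size_polyN geq_max (leq_trans (size_polyC_leq1 _)) // andbT.
by case: (i == j); rewrite ?mulr1n ?mulr0n ?size_polyX ?size_poly0.
Qed.

(** Cofactors are minors of order [n - 1] with entries of degree at most 1, so their degree stays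
    below that of [char_poly A]. *)
Lemma size_adj_char_poly_mx (R : idomainType) n (A : 'M[R]_n) i j :
  (size (\adj (char_poly_mx A) i j) <= n)%N.
Proof.
case: n A i j => [|n] A i j; first by case: i.
rewrite mxE /cofactor size_Msign; apply: size_det_affine => k l; rewrite 2!mxE; exact: size_char_poly_mx_entry.
Qed.

(** * Strictly proper rational functions and polynomial parts *)

Section StrictlyProper.
Variable R : realType.
Implicit Types f g : ratfun R.

Lemma strictly_proper0 : strictly_proper (0 : ratfun R).
Proof. by exists 0, 1; rewrite oner_eq0 size_poly0 size_poly1 tofrac0 mul0r. Qed.

Lemma strictly_properD f g :
  strictly_proper f -> strictly_proper g -> strictly_proper (f + g).
Proof.
move=> [a [b [b0 ab ->]]] [c [d [d0 cd ->]]].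
have [bF dF] : tofrac b != 0 :> ratfun R /\ tofrac d != 0 :> ratfun R.
  by rewrite !tofrac_eq0.
exists (a * d + c * b), (b * d); split; first by rewrite mulf_neq0.
- have size_lt (u v w : {poly R}) : w != 0 -> (size u < size v)%N ->
      (size (u * w)%R < (size v + size w).-1)%N.
    move=> w0 uv; apply: leq_ltn_trans (size_polyMleq _ _) _.
    move: w0; rewrite -size_poly_gt0; case: (size w) => // k _.
    by rewrite !addnS /= ltn_add2r.
  rewrite size_mul // (leq_ltn_trans (size_polyD _ _)) // gtn_max size_lt //=.
  by rewrite [(size b + _)%N]addnC size_lt.
- by rewrite (addf_div _ _ bF dF) tofracD (tofracM a) (tofracM c) (tofracM b).
Qed.

Lemma strictly_properZ (a : R) f :
  strictly_proper f -> strictly_proper (tofrac a%:P * f).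
Proof.
move=> [p [q [q0 pq ->]]]; exists (a *: p), q; split=> //.
  exact: leq_ltn_trans (size_scale_leq _ _) pq.
by rewrite -mul_polyC tofracM mulrA.
Qed.

Lemma strictly_proper_mulmx m n (M : 'M[R]_(m, n)) (F : 'cV[ratfun R]_n) :
  (forall i, strictly_proper (F i 0)) ->
  forall i, strictly_proper ((ratmx (polymx M) *m F) i 0).
Proof.
move=> sF i; rewrite mxE; elim/big_rec: _ => [|j f _ sf].
  exact: strictly_proper0.
by apply: strictly_properD => //; rewrite !mxE; apply: strictly_properZ.
Qed.

(** Cramer's rule: [F] is the adjugate applied to [v], of degree below [n], divided by the
    characteristic polynomial, of degree [n]. *)
Lemma strictly_proper_resolvent n (A : 'M[R]_n) (F : 'cV[ratfun R]_n)
    (v : 'cV[R]_n) :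
  ratmx (char_poly_mx A) *m F = ratmx (polymx v) ->
  forall i, strictly_proper (F i 0).
Proof.
move=> eF i; pose d := char_poly A.
have d0 : d != 0 by rewrite -size_poly_gt0 size_char_poly.
have dF : tofrac d != 0 :> ratfun R by rewrite tofrac_eq0.
have {}eF : tofrac d *: F = ratmx (\adj (char_poly_mx A) *m polymx v).
  rewrite map_mxM /= -eF mulmxA -map_mxM /= mul_adj_mx.
  by rewrite map_scalar_mx mul_scalar_mx.
exists ((\adj (char_poly_mx A) *m polymx v) i 0), d; split=> //.
  rewrite size_char_poly ltnS mxE; apply: leq_trans (size_sum _ _ _) _.
  apply/bigmax_leqP => j _; rewrite [polymx v j 0]mxE mulrC mul_polyC.
  apply: leq_trans (size_scale_leq _ _) _.
  exact: size_adj_char_poly_mx.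
apply: (mulfI dF); rewrite mulrC [RHS]mulrC divfK //.
by move/matrixP/(_ i 0): eF; rewrite !mxE => <-; rewrite mulrC.
Qed.

Lemma poly_part_uniq n (F : 'cV[ratfun R]_n) P Q :
  poly_part F P -> poly_part F Q -> P = Q.
Proof. by have [P0 [_ uP0]] := poly_partP F => /uP0 <- /uP0. Qed.

Lemma poly_part_strictly_proper n (F : 'cV[ratfun R]_n) :
  (forall i, strictly_proper (F i 0)) -> poly_part F 0.
Proof. by move=> sF; exists F => //; rewrite map_mx0 addr0. Qed.

Lemma poly_part_poly n (P : 'cV[{poly R}]_n) : poly_part (ratmx P) P.
Proof.
by exists 0; rewrite ?add0r // => i; rewrite mxE; apply: strictly_proper0.
Qed.

Lemma poly_part_mulmx m n (M : 'M[R]_(m, n)) (F : 'cV[ratfun R]_n) P :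
  poly_part F P -> poly_part (ratmx (polymx M) *m F) (polymx M *m P).
Proof.
move=> [FA sFA ->]; exists (ratmx (polymx M) *m FA).
  exact: strictly_proper_mulmx.
by rewrite mulmxDr map_mxM.
Qed.

End StrictlyProper.

(** * Equality of ranks in terms of kernels *)

Section RankKernel.
Variable F : fieldType.

(** Under the inclusion of row spaces, equal ranks mean [N <= B], that is, [N] kills [cokermx B];
    the columns of [cokermx B] lie in the kernel of [B]. *)
Lemma mxrank_eq_kernelP p q n (B : 'M[F]_(p, n)) (N : 'M[F]_(q, n)) :
  (B <= N)%MS ->
  \rank B = \rank N <-> (forall v : 'cV[F]_n, B *m v = 0 -> N *m v = 0).
Proof.
move=> sBN; split=> [eBN v Bv0 | kBN].
  have /submxP[D ->] : (N <= B)%MS.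
    by rewrite -(mxrank_leqif_sup sBN) eBN.
  by rewrite -mulmxA Bv0 mulmx0.
apply/eqP; rewrite (mxrank_leqif_sup sBN) submxE.
apply/eqP/matrixP => i j; rewrite mxE.
have /kBN : B *m col j (cokermx B) = 0.
  by rewrite colE mulmxA mulmx_coker mul0mx.
by rewrite colE mulmxA -colE => /matrixP/(_ i 0); rewrite !mxE.
Qed.

End RankKernel.

(** * The rank condition and its independence of [r] *)

Section RankCondition.
Variables (R : realType) (m n : nat) (N : 'M[R]_n) (C : 'M[R]_(m, n)).

Definition impulse_free := forall v : 'cV[R]_n,
  (forall i, C *m N ^+ i.+1 *m v = 0) -> N *m v = 0.

Lemma rank_condition_kernelP r :
  rank_condition N C r <->
  forall v : 'cV[R]_n, N ^+ r.+2 *m v = 0 ->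
    (forall i, (i <= r)%N -> C *m N ^+ i.+1 *m v = 0) -> N *m v = 0.
Proof.
have sub : (col_mx (N ^+ r.+2) (\mxcol_(i < r.+1) (C *m N ^+ i.+1)) <= N)%MS.
  rewrite col_mx_sub exprSr submxMl /=.
  under eq_mxcol do rewrite exprSr mulmxA.
  by rewrite -mxcol_mul submxMl.
apply: iff_trans (mxrank_eq_kernelP sub) _; split=> kB v.
  move=> Nv0 CNv0; apply: kB; rewrite mul_col_mx Nv0 mxcol_mul.
  under eq_mxcol => i do rewrite CNv0 -1?ltnS //.
  by rewrite mxcol0 col_mx0.
rewrite mul_col_mx -[RHS]col_mx0 => /eq_col_mx[Nv0 CNv0].
apply: kB => // i ir; move: CNv0.
move/(congr1 (fun M => submxcol M (Ordinal (ir : (i < r.+1)%N)))).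
by rewrite -submxcol_mul mxcolK submxcol0.
Qed.

Hypothesis nilN : nilpotent_mx N.

Lemma rank_condition_impulse_free r : rank_condition N C r -> impulse_free.
Proof.
move=> /rank_condition_kernelP rkN v Cv0; apply/eqP/negPn/negP => Nv0.
have nil : exists k, N ^+ k *m v == 0.
  by case: nilN => k Nk; exists k; rewrite Nk mul0mx.
(* The least exponent killing [v] is neither 0 nor 1, since [N *m v] is nonzero. Writing it [k.+2],
   the vector [N ^+ k *m v] is killed by [N ^+ 2], hence by [N ^+ r.+2], but not by [N]. *)
case: (ex_minnP nil) => -[|[|k]] /eqP Nkv min_k.
- by move: Nv0; rewrite -[v]mul1mx Nkv mulmx0 eqxx.
- by move: Nv0; rewrite -[N]expr1 Nkv eqxx.
suff : N *m (N ^+ k *m v) = 0.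
  by rewrite mulmxA mulmxE -exprS => /eqP/min_k; rewrite ltnn.
apply: rkN => [|i _].
  rewrite mulmxA mulmxE -exprD addSn addSn -addnS -addnS exprD -mulmxE.
  by rewrite -mulmxA Nkv mulmx0.
rewrite mulmxA -[C *m _ *m _]mulmxA mulmxE -exprD addSn; exact: Cv0.
Qed.

Lemma impulse_free_rank_condition r : impulse_free -> rank_condition N C r.
Proof.
move=> free; apply/rank_condition_kernelP => v Nv0 Cv0; apply: free => i.
have [/Cv0 // | ri] := leqP i r.
(* For [i > r], the power [N ^+ i.+1] has [N ^+ r.+2] as a right factor. *)
rewrite -(subnK (ri : (r.+2 <= i.+1)%N)) exprD -mulmxE -2!mulmxA Nv0.
by rewrite !mulmx0.
Qed.

End RankCondition.

(** * Invariance of impulse observability under changes of coordinates *)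

Section PencilEquivalence.
Variables (R : realType) (m n : nat).
Implicit Types (E A S T : 'M[R]_n) (C : 'M[R]_(m, n)).

Lemma pencil_mulmx E A S T :
  polymx T *m pencil E A *m polymx S = pencil (T *m E *m S) (T *m A *m S).
Proof.
by rewrite /pencil mulmxBr mulmxBl -scalemxAr -scalemxAl !map_mxM.
Qed.

Lemma pencil_inj E A E' A' : pencil E A = pencil E' A' -> E = E' /\ A = A'.
Proof.
move=> eEA; split; apply/matrixP => i j; move/matrixP/(_ i j): eEA;
  rewrite !mxE => /polyP.
  by move/(_ 1%N); rewrite !coefB !coefXM !coefC /= !subr0.
by move/(_ 0%N); rewrite !coefB !coefXM !coefC /= !sub0r => /oppr_inj.
Qed.

Lemma impulse_equationE E A C (w : 'cV[R]_n) (X : 'cV[ratfun R]_n) :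
  ratmx (col_mx (pencil E A) (polymx C)) *m X
    = ratmx (polymx (col_mx (E *m w) 0)) <->
  ratmx (pencil E A) *m X = ratmx (polymx (E *m w)) /\
  ratmx (polymx C) *m X = 0.
Proof.
rewrite !map_col_mx mul_col_mx !map_mx0.
by split=> [/eq_col_mx | [-> ->]].
Qed.

Lemma impulse_observable_mulmx E A C S T : T \in unitmx -> S \in unitmx ->
  impulse_observable E A C ->
  impulse_observable (T *m E *m S) (T *m A *m S) (C *m S).
Proof.
move=> uT uS obs [w [X [XP [/impulse_equationE[eX eC] pX XP0]]]]; apply: obs.
(* The substitution by [S] carries a solution of the transformed system to one of the original
   system; as a constant matrix, [S] also acts on polynomial parts. *)
exists (S *m w), (ratmx (polymx S) *m X), (polymx S *m XP); split.
- apply/impulse_equationE; split; last by rewrite mulmxA -!map_mxM.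
  (* Left multiplication by [T] is injective over the rational functions, so the equation may be
     checked after multiplying by [T]. *)
  have cancelT : cancel (mulmx (ratmx (polymx T)))
      (@mulmx (ratfun R) n n 1 (ratmx (polymx (invmx T)))).
    by move=> M; rewrite mulmxA -!map_mxM mulVmx // !map_mx1 mul1mx.
  apply: (can_inj cancelT); rewrite 2!mulmxA -2!map_mxM mulmxA -map_mxM.
  by rewrite pencil_mulmx eX -!map_mxM !mulmxA.
- exact: poly_part_mulmx.
apply: contra_neq XP0 => /(congr1 (mulmx (polymx (invmx S)))).
by rewrite mulmx0 mulmxA -map_mxM mulVmx // map_mx1 mul1mx.
Qed.

Lemma impulse_observable_equiv E A C S T : T \in unitmx -> S \in unitmx ->
  impulse_observable E A C <->
  impulse_observable (T *m E *m S) (T *m A *m S) (C *m S).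
Proof.
move=> uT uS; split=> [|obs]; first exact: impulse_observable_mulmx.
have cancelTS (M : 'M[R]_n) : invmx T *m (T *m M *m S) *m invmx S = M.
  by rewrite -!mulmxA mulmxV // mulmx1 mulmxA mulVmx // mul1mx.
rewrite -[E]cancelTS -[A]cancelTS -(mulmxK uS C).
by apply: impulse_observable_mulmx; rewrite ?unitmx_inv.
Qed.

End PencilEquivalence.

(** * Systems in Weierstrass form *)

Section CanonicalForm.
Variables (R : realType) (m n1 n2 : nat).
Variables (A1 : 'M[R]_n1) (N : 'M[R]_n2).
Variables (C1 : 'M[R]_(m, n1)) (C2 : 'M[R]_(m, n2)).

Lemma pencil_block :
  pencil (block_mx 1%:M 0 0 N) (block_mx A1 0 0 1%:M)
    = block_mx (char_poly_mx A1) 0 0 (pencil N 1%:M).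
Proof.
rewrite /pencil !map_block_mx !map_mx0 !map_mx1 scale_block_mx opp_block_mx.
by rewrite add_block_mx !scaler0 !oppr0 !addr0 scalemx1.
Qed.

(** The truncated Neumann series of the inverse of [sN - I], exact once [N ^+ k = 0]. *)
Definition fast_resolvent k : 'M[{poly R}]_n2 :=
  - \sum_(i < k) 'X^i *: polymx (N ^+ i).

Lemma mul_fast_resolvent_pencil k :
  N ^+ k = 0 -> fast_resolvent k *m pencil N 1%:M = 1%:M.
Proof.
move=> Nk; rewrite /pencil map_mx1 mulNmx mulmx_suml.
under eq_bigr do rewrite mulmxBr mulmx1 -scalemxAl -scalemxAr -map_mxM mulmxE
  -exprSr scalerA -exprSr.
(* Each summand is now [F i.+1 - F i], so the sum telescopes to [F k - F 0], where [F k = 0] and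
   [F 0 = 1]. *)
pose F i : 'M[{poly R}]_n2 := 'X^i *: polymx (N ^+ i).
rewrite -(big_mkord xpredT (fun i => F i.+1 - F i)).
by rewrite telescope_sumr // /F Nk map_mx0 scaler0 !expr0 map_mx1 scale1r sub0r opprK.
Qed.

Lemma mul_pencil_fast_resolvent k :
  N ^+ k = 0 -> pencil N 1%:M *m fast_resolvent k = 1%:M.
Proof. by move=> Nk; apply/mulmx1C/mul_fast_resolvent_pencil. Qed.

Lemma output_fast_resolvent k (v : 'cV[R]_n2) :
  polymx C2 *m (fast_resolvent k *m polymx (N *m v))
    = - \sum_(i < k) 'X^i *: polymx (C2 *m N ^+ i.+1 *m v).
Proof.
rewrite mulNmx mulmxN mulmx_suml mulmx_sumr; congr (- _).
apply: eq_bigr => i _; rewrite -scalemxAl -scalemxAr -!map_mxM exprSr.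
by rewrite -mulmxE !mulmxA.
Qed.

Lemma coef_output_fast_resolvent k (v : 'cV[R]_n2) :
  polymx C2 *m (fast_resolvent k *m polymx (N *m v)) = 0 ->
  forall i, (i < k)%N -> C2 *m N ^+ i.+1 *m v = 0.
Proof.
rewrite output_fast_resolvent => /eqP; rewrite oppr_eq0 => /eqP out0 i ik.
apply/colP => j; move/matrixP/(_ j 0)/polyP/(_ i): out0.
(* The other summands are constants times ['X^l] with [l] different from [i], so only the term of
   index [i] contributes to this coefficient. *)
rewrite summxE coef_sum (bigD1 (Ordinal ik)) //= big1 ?addr0.
  by rewrite !mxE coefXnM ltnn subnn coefC coef0.
move=> l li; rewrite !mxE coefXnM coefC subn_eq0.
by case: ltngtP => // il; case/eqP: li; apply: val_inj.
Qed.

Lemma impulse_observable_canonical : nilpotent_mx N ->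
  impulse_observable (block_mx 1%:M 0 0 N) (block_mx A1 0 0 1%:M) (row_mx C1 C2)
    <-> impulse_free N C2.
Proof.
case=> k Nk; split=> [obs v Cv0 | free [w [X [XP [/impulse_equationE[]]]]]].
  apply/eqP/negPn/negP => Nv0; apply: obs.
  (* With the slow part zero, the output only sees the coefficients [C2 *m N ^+ i.+1 *m v], which
     all vanish. Being polynomial, [Z] is its own polynomial part. *)
  pose Z := col_mx (0 : 'cV[{poly R}]_n1) (fast_resolvent k *m polymx (N *m v)).
  exists (col_mx 0 v), (ratmx Z), Z; split.
  - apply/impulse_equationE; rewrite -!map_mxM pencil_block /Z.
    rewrite !mul_block_col !mulmx0 !mul0mx !add0r !mulmxA.
    rewrite mul_pencil_fast_resolvent // mul1mx; split; first by rewrite !map_col_mx !map_mx0.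
    rewrite map_row_mx mul_row_col mulmx0 add0r output_fast_resolvent.
    rewrite big1 ?oppr0 ?map_mx0 // => i _.
    by rewrite Cv0 map_mx0 scaler0.
  - exact: poly_part_poly.
  (* [Z] is nonzero because [sN - I] maps its lower block back to [N *m v]. *)
  apply: contra_neq Nv0 => /eqP; rewrite col_mx_eq0 => /andP[_ /eqP].
  move/(congr1 (mulmx (pencil N 1%:M))).
  rewrite mulmxA mul_pencil_fast_resolvent // mul1mx mulmx0.
  move/matrixP=> e; apply/matrixP => i j; move: (e i j).
  by rewrite !mxE => /polyC_inj.
rewrite -[w]vsubmxK -[X]vsubmxK; move: (usubmx w) (dsubmx w) => w1 v.
move: (usubmx X) (dsubmx X) => {w X} X1 X2.
rewrite pencil_block map_block_mx !mul_block_col !map_mx0 !mul0mx mul1mx.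
rewrite addr0 !add0r !map_col_mx !map_row_mx mul_row_col => /eq_col_mx[e1 e2] eC pX.
have sp1 := strictly_proper_resolvent e1.
have eX2 : X2 = ratmx (fast_resolvent k *m polymx (N *m v)).
  rewrite map_mxM -e2 mulmxA -map_mxM mul_fast_resolvent_pencil //.
  by rewrite map_mx1 mul1mx.
(* The output equation writes zero as the strictly proper [C1 X1] plus the polynomial [C2 X2];
   uniqueness of the polynomial part makes the latter vanish. *)
have out0 : polymx C2 *m (fast_resolvent k *m polymx (N *m v)) = 0.
  apply: (@poly_part_uniq _ _ 0).
    exists (ratmx (polymx C1) *m X1); first exact: strictly_proper_mulmx.
    by rewrite map_mxM -eX2 eC.
  by apply: poly_part_strictly_proper => i; rewrite mxE; apply: strictly_proper0.
have Nv0 : N *m v = 0.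
  apply: free => i; have [/(coef_output_fast_resolvent out0) // | ki] := ltnP i k.
  by rewrite -(subnK (leqW ki)) exprD Nk mulr0 mulmx0 mul0mx.
(* Now [X2 = 0] and [X1] is strictly proper, so the polynomial part [XP] is 0, against its
   choice. *)
case/eqP; apply: (poly_part_uniq pX); apply: poly_part_strictly_proper => i.
rewrite eX2 Nv0 map_mx0 mulmx0 map_mx0 mxE.
by case: splitP => j _; rewrite ?mxE; [exact: sp1 | exact: strictly_proper0].
Qed.

End CanonicalForm.

Theorem corollary3p2 (R : realType) (n m n1 n2 : nat) (hn : (n1 + n2)%N = n)
    (E A : 'M[R]_n) (C : 'M[R]_(m, n)) (T S : 'M[R]_n)
    (A1 : 'M[R]_n1) (N : 'M[R]_n2) (C1 : 'M[R]_(m, n1)) (C2 : 'M[R]_(m, n2))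
    (singE : \det E = 0) (regEA : regular_pencil E A)
    (decW : weierstrass_decomposition hn E A C T S A1 N C1 C2) :
  (impulse_observable E A C <->
     exists r : nat, (r < n)%N /\ rank_condition N C2 r) /\
  (impulse_observable E A C <->
     forall r : nat, (r < n)%N -> rank_condition N C2 r).
Proof.
(* Singularity of [E] excludes [n = 0], where the determinant is 1; thus [r = 0] is an admissible
   index. *)
have n_gt0 : (0 < n)%N.
  case: n E singE {hn A C T S regEA decW} => // E.
  by rewrite det_mx00 => /eqP; rewrite oner_eq0.
suff obsP : impulse_observable E A C <-> impulse_free N C2.
  have [_ _ nilN _] := decW.
  split; apply: (iff_trans obsP); split.
  - by exists 0%N; split=> //; apply: impulse_free_rank_condition.
  - by case=> r [_]; apply: rank_condition_impulse_free.
  - by move=> free r _; apply: impulse_free_rank_condition.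
  - by move/(_ 0%N n_gt0); apply: rank_condition_impulse_free.
(* Eliminating [hn] replaces [n] by [n1 + n2], which makes the casts trivial. *)
move: E A C T S decW {singE regEA n_gt0}; case: n / hn => E A C T S.
case=> uT uS nilN; rewrite !castmx_id mul_block_col !mul0mx addr0 add0r mul1mx.
rewrite mul_col_mx -map_row_mx => /eq_col_mx[].
have -> : block_mx ('X *: 1%:M - polymx A1) 0 0 ('X *: polymx N - 1%:M)
    = pencil (block_mx 1%:M 0 0 N) (block_mx A1 0 0 1%:M).
  by rewrite pencil_block /char_poly_mx /pencil map_mx1 scalemx1.
(* Comparing coefficients of [s] identifies [T E S] and [T A S] with the two constant block
   matrices. *)
rewrite pencil_mulmx -map_mxM => /pencil_inj[eE eA] eC.
apply: iff_trans (impulse_observable_equiv _ _ _ uT uS) _.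
rewrite eE eA (map_mx_inj eC); exact: impulse_observable_canonical.
Qed.
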